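(* Let $S=\bigcup_{r=1}^R S_r\subseteq\mathbb{R}^n$ where each $S_r$ is a linear subspace of $\mathbb{R}^n$. Let $x^*\in S$ and $d\in T_S(x^* )$. Then the regular normal cone to $T_S(x^* )$ at $d$ is $$\hat N_{T_S(x^* )}(d)=\bigcap_{r\in I(x^* )\cap I(d)}S_r^\perp.$$
   Context: $T_S(x^* )$ is the Bouligand (contingent) tangent cone to $S$ at $x^*$; $\hat N_\Omega(y)$ is the Fréchet (regular) normal cone to a closed set $\Omega$ at $y\in\Omega$. For $y\in\mathbb{R}^n$, $I(y)=\{r\in\{1,\dots,R\} : y\in S_r\}$. *)

(* Defs.v *)
From HB Require Import structures.
From mathcomp Require Export all_boot all_order all_algebra.
From mathcomp Require Export all_classical all_reals all_analysis.
Export Order.TTheory GRing.Theory Num.Theory.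
Export numFieldNormedType.Exports.

Set Implicit Arguments.
Unset Strict Implicit.
Unset Printing Implicit Defensive.

Local Open Scope classical_set_scope.
Local Open Scope ring_scope.

(* The library norm on 'rV[R]_n is the maximum norm, so the Euclidean structure
   is introduced explicitly; both norms induce the library topology. *)
Definition dot (R : realType) (n : nat) (u v : 'rV[R]_n) : R :=
  \sum_(i < n) u 0 i * v 0 i.

Definition enorm (R : realType) (n : nat) (u : 'rV[R]_n) : R :=
  Num.sqrt (dot u u).

Definition orthocomp (R : realType) (n : nat) (U : {vspace 'rV[R]_n}) :
    set 'rV[R]_n :=
  [set v | forall u, u \in U -> dot v u = 0].

Definition tangent_cone (R : realType) (n : nat) (A : set 'rV[R]_n)
    (x : 'rV[R]_n) : set 'rV[R]_n :=
  [set d | exists (t : nat -> R) (e : nat -> 'rV[R]_n),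
    [/\ forall k, 0 < t k,
        t k @[k --> \oo] --> (0 : R),
        e k @[k --> \oo] --> d
      & forall k, A (x + t k *: e k)]].

(* limsup of <v, z - y> / ||z - y|| as z -> y with z in A and z <> y is at most
   0. If y is isolated in A the limsup is -oo and every v is normal. Only
   meaningful for y in A. *)
Definition regular_normal_cone (R : realType) (n : nat) (A : set 'rV[R]_n)
    (y : 'rV[R]_n) : set 'rV[R]_n :=
  [set v | (limf_esup (fun z : 'rV[R]_n =>
                         (dot v (z - y) / enorm (z - y))%:E)
                      (within A y^') <= 0)%E].

Definition subspace_union (R : realType) (n m : nat)
    (S : 'I_m -> {vspace 'rV[R]_n}) : set 'rV[R]_n :=
  [set y | exists r, y \in S r].

Definition active_indices (R : realType) (n m : nat)
    (S : 'I_m -> {vspace 'rV[R]_n}) (y : 'rV[R]_n) : set 'I_m :=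
  [set r | y \in S r].

(* Main.v *)
Require Import Defs.

Local Open Scope classical_set_scope.
Local Open Scope ring_scope.

(** Because there are finitely many subspaces and each of them is closed, any
    point has a neighbourhood meeting only the members of the family that
    contain it ([near_notin_vspace]). This is used twice.

    Around [x], the union therefore looks like the union of the [S r] through
    [x], which is a cone with apex [x]; so the tangent cone at [x] is exactly
    the union of these [S r] ([tangent_cone_subspace_union]).

    Around [d], the tangent cone in turn looks like the union of the [S r]
    that contain both [x] and [d]. For each such [r], the displacements
    [z - d] with [z] in [S r] stay in [S r]; hence a vector orthogonal to all
    of these [S r] has zero inner product with every small displacement and is
    a regular normal ([regular_normal_near]). Conversely, for [w] in such an
    [S r], the ray from [d] in direction [w] lies in the tangent cone, which
    forces a regular normal to have nonpositive inner product with [w]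
    ([regular_normal_ray]); applied to [w] and [- w], this gives
    orthogonality. *)

Lemma linear_rV_continuous (R : realType) (n : nat) (V : normedModType R)
    (f : {linear 'rV[R]_n -> V}) : continuous f.
Proof.
have fE : f =1 fun v : 'rV[R]_n => \sum_(j < n) v 0 j *: f (delta_mx 0 j).
  move=> v; rewrite {1}[v]row_sum_delta linear_sum.
  by apply: eq_bigr => j _; rewrite linearZ.
rewrite (funext fE); apply: continuous_big => [|j _ v].
  exact: add_continuous.
have cv : M 0 j @[M --> v] --> v 0 j by exact: coord_continuous.
exact: cvgZl cv.
Qed.

(** A subspace is the zero set of the continuous map subtracting from a vector
    its projection on that subspace. *)
Lemma vspace_closed (R : realType) (n : nat) (U : {vspace 'rV[R]_n}) :
  closed [set v | v \in U].
Proof.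
have -> : [set v | v \in U] = (fun v => v - projv U v) @^-1` [set 0].
  apply/seteqP; split => v /=; first by move/projv_id ->; rewrite subrr.
  by move/subr0_eq ->; exact: memv_proj.
apply: preimage_closed.
  move=> v _; apply: (cvgB (F := nbhs v)); first exact: cvg_id.
  exact: linear_rV_continuous.
exact/accessible_closed_set1/hausdorff_accessible/norm_hausdorff.
Qed.

(** The localization principle behind the whole proof: what converges to a
    point outside a subspace eventually leaves that subspace. *)
Lemma near_notin_vspace {R : realType} {n : nat} {U : {vspace 'rV[R]_n}}
    {T : Type} {F : set_system T} {u : T -> 'rV[R]_n} {y : 'rV[R]_n} :
  Filter F -> u z @[z --> F] --> y -> y \notin U ->
  \forall z \near F, u z \notin U.
Proof.
move=> FF uy yU; apply: (uy [set v | v \notin U]).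
apply: open_nbhs_nbhs; split; last exact: yU.
have -> : [set v | v \notin U] = ~` [set v | v \in U].
  by apply/seteqP; split => v /negP.
exact/closed_openC/vspace_closed.
Qed.

(** For the inclusion from left to right, suppose that no [S r] contains both
    [x] and [d], and that the points [x + t k *: e k] approach [x] with [e k]
    tending to [d]. If [S r] misses [x], it misses these points eventually; if
    it contains [x] but not [d], it eventually misses [e k], hence these points
    too. As there are finitely many [r], the points eventually leave the union
    altogether. *)
Lemma tangent_cone_subspace_union (R : realType) (n m : nat)
    (S : 'I_m -> {vspace 'rV[R]_n}) (x : 'rV[R]_n) :
  tangent_cone (subspace_union S) x =
  \bigcup_(r in active_indices S x) [set d | d \in S r].
Proof.
apply/seteqP; split => d.
- move=> [t [e [t0 tcvg ecvg Sxte]]]; apply: contrapT => nact.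
  have xte : x + t k *: e k @[k --> \oo] --> x.
    rewrite -[X in _ --> X]addr0 -(scale0r d).
    by apply: cvgD; [exact: cvg_cst | exact: cvgZ].
  have : \forall k \near \oo, forall r, x + t k *: e k \notin S r.
    apply: filter_forall => r.
    have [xSr|] := boolP (x \in S r); last exact: near_notin_vspace.
    have dSr : d \notin S r by apply/negP => dSr; apply: nact; exists r.
    have : \forall k \near \oo, e k \notin S r by exact: near_notin_vspace dSr.
    apply: filterS => k.
    apply: contra => xSte.
    have : t k *: e k \in S r by rewrite -(addKr x (_ *: _)) memvD ?memvN.
    by rewrite rpredZeq gt_eqF.
  case=> N _ /(_ N (leqnn N)) notS.
  by have [r] := Sxte N; exact/negP.
- move=> [r /= xSr dSr]; exists harmonic, (fun=> d); split => //=.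
  + exact: cvg_harmonic.
  + exact: cvg_cst.
  + by move=> k; exists r; rewrite memvD ?memvZ.
Qed.

Lemma dotDr {R : realType} {n : nat} (v u w : 'rV[R]_n) :
  dot v (u + w) = dot v u + dot v w.
Proof. by rewrite -big_split; apply: eq_bigr => i _; rewrite mxE mulrDr. Qed.

Lemma dotZr {R : realType} {n : nat} (a : R) (v u : 'rV[R]_n) :
  dot v (a *: u) = a * dot v u.
Proof. by rewrite mulr_sumr; apply: eq_bigr => i _; rewrite mxE mulrCA. Qed.

Lemma dotNr {R : realType} {n : nat} (v u : 'rV[R]_n) :
  dot v (- u) = - dot v u.
Proof. by rewrite -scaleN1r dotZr mulN1r. Qed.

Lemma enorm_ge0 {R : realType} {n : nat} (u : 'rV[R]_n) : 0 <= enorm u.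
Proof. exact: sqrtr_ge0. Qed.

Lemma enorm_gt0 {R : realType} {n : nat} (u : 'rV[R]_n) :
  u != 0 -> 0 < enorm u.
Proof.
apply: contraNT; rewrite sqrtr_gt0 -leNgt => uu.
have uu_ge0 i : true -> 0 <= u 0 i * u 0 i by rewrite -expr2 sqr_ge0.
have /eqP : dot u u = 0 by apply/le_anti; rewrite uu sumr_ge0.
rewrite psumr_eq0 // => /allP u0.
apply/eqP/rowP => i; rewrite mxE.
by have := u0 i (mem_index_enum i); rewrite mulf_eq0 orbb => /eqP.
Qed.

Lemma enormZ {R : realType} {n : nat} (a : R) (u : 'rV[R]_n) :
  0 <= a -> enorm (a *: u) = a * enorm u.
Proof.
move=> a0; rewrite /enorm dotZr.
have -> : dot (a *: u) u = a * dot u u.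
  by rewrite mulr_sumr; apply: eq_bigr => i _; rewrite mxE mulrA.
by rewrite mulrA -expr2 sqrtrM ?sqr_ge0 // sqrtr_sqr ger0_norm.
Qed.

(** The quotients whose upper limit defines the normal cone have a nonnegative
    denominator, so only the sign of the inner product matters. *)
Lemma regular_normal_near {R : realType} {n : nat} {A : set 'rV[R]_n}
    {y v : 'rV[R]_n} :
  (\forall z \near y, A z -> dot v (z - y) <= 0) ->
  regular_normal_cone A y v.
Proof.
move=> vle0; set V := [set z | dot v (z - y) <= 0].
have VN : within A y^' V.
  rewrite /dnbhs /within /=; apply: filterS vle0 => z Vz _; exact: Vz.
apply: le_trans (ereal_inf_lbound _) _; first by exists V.
apply/ge_ereal_sup => _ [z Vz <-].
by rewrite lee_fin mulr_le0_ge0 // invr_ge0 enorm_ge0.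
Qed.

(** For nonzero [u], along the ray from [y] in direction [u] the quotient is constant, equal to
    [dot v u / enorm u], so the upper limit at [y] is at least that constant. *)
Lemma regular_normal_ray {R : realType} {n : nat} {A : set 'rV[R]_n}
    {y v u : 'rV[R]_n} :
  (forall s, 0 < s -> A (y + s *: u)) ->
  regular_normal_cone A y v -> dot v u <= 0.
Proof.
move=> Aray vN; rewrite leNgt; apply/negP => vu.
have u0 : u != 0.
  by apply: contraTneq vu => ->; rewrite -(scale0r u) dotZr mul0r ltxx.
have c0 : (0 < (dot v u / enorm u)%:E)%E by rewrite lte_fin divr_gt0 ?enorm_gt0.
have /ereal_inf_lt[_ [V VN <-]] := le_lt_trans vN c0.
apply/negP; rewrite -leNgt.
have ray_cvg : y + s *: u @[s --> 0^'+] --> y.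
  apply: cvg_at_right_filter; rewrite -[X in _ --> X]addr0 -(scale0r u).
  by apply: cvgD; [exact: cvg_cst | apply: cvgZl; exact: cvg_id].
have [s [/= s0 Vs]] := filter_ex (filterI (nbhs_right_gt 0) (ray_cvg _ VN)).
have {}Vs : V (y + s *: u).
  apply: Vs; last exact: Aray.
  by rewrite /= -subr_eq0 addrC addKr scaler_eq0 negb_or gt_eqF.
apply: ereal_sup_ubound; exists (y + s *: u) => //.
by rewrite addrC addKr dotZr enormZ ?ltW // -mulf_div divff ?mul1r // gt_eqF.
Qed.

Theorem proposition2p2 (R : realType) (n m : nat)
    (S : 'I_m -> {vspace 'rV[R]_n}) (x d : 'rV[R]_n)
    (hx : subspace_union S x)
    (hd : tangent_cone (subspace_union S) x d) :
  regular_normal_cone (tangent_cone (subspace_union S) x) d =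
  \bigcap_(r in active_indices S x `&` active_indices S d) orthocomp (S r).
Proof.
rewrite tangent_cone_subspace_union; apply/seteqP; split => v.
- move=> vN r [xSr dSr].
  have vle0 w : w \in S r -> dot v w <= 0.
    move=> wSr; apply: regular_normal_ray vN => s _.
    by exists r => //=; rewrite memvD ?memvZ.
  move=> u uSr; apply/le_anti.
  by rewrite vle0 // -oppr_le0 -dotNr vle0 ?memvN.
- move=> vort; apply: regular_normal_near.
  have : \forall z \near d, forall r, d \notin S r -> z \notin S r.
    apply: (@filter_forall _ _ _ (nbhs d)) => r; apply: filter_imply => dSr.
    exact: (near_notin_vspace (u := id)) dSr.
  apply: filterS => z zloc [r /= xSr zSr].
  have dSr : d \in S r by apply: contraLR zSr => /zloc.
  by rewrite (vort r) ?memvB.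
Qed.
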